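(* Let $R$ be a (commutative) principal ideal domain, $\mathsf R$ a multivariate Ore extension of $R$, $F=\{g_1,\dots,g_u\}\subset\mathsf R^m\setminus\{0\}$, $\mathbf M(g_i)=c_i\tau_i\mathbf e_{l_i}$. The following hold. (1) For all $i,j,k\in\{1,\dots,u\}$ with $\mathbf e_{l_i}=\mathbf e_{l_j}=\mathbf e_{l_k}$, $$\frac{c(i,j,k)}{c(i,k)}\,b_W(i,k)\,\frac{\tau(i,j,k)}{\tau(i,k)}-\frac{c(i,j,k)}{c(i,j)}\,b_W(i,j)\,\frac{\tau(i,j,k)}{\tau(i,j)}+\frac{c(i,j,k)}{c(k,j)}\,b_W(k,j)\,\frac{\tau(i,j,k)}{\tau(k,j)}=0.$$ (2) $\{\{i,j\}:1\le i<j\le u,\ \mathbf e_{l_i}=\mathbf e_{l_j},\ \{i,j\}\text{ not redundant}\}$ is a restricted useful S-pair set for $F$. (3) Let $G=\{g_1,\dots,g_s\}$, $s\le u$, and let $\mathfrak{GM}_*\subset\{\{i,j\}:1\le i<j<s,\ \mathbf e_{l_i}=\mathbf e_{l_j}\}$ be a restricted useful S-pair set for $\{g_1,\dots,g_{s-1}\}$. Let $\overline M=\{\mathbf M(j,s):1\le j<s,\ \mathbf e_{l_j}=\mathbf e_{l_s}\}$ and let $\overline M'\subset\overline M$ be the set of those $\mu=\mathbf M(j,s)\in\overline M$ such that either there is $\mathbf M(j',s)\in\overline M$ with $\mathbf M(j',s)\mid\mathbf M(j,s)\ne\mathbf M(j',s)$, or (in the ideal case) there is $i_\mu$, $1\le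 i_\mu<s$, with $\mathbf M(i_\mu)\diamond\mathbf M(s)=\mathbf M(i_\mu,s)=\mu$. For each $\mu\in\overline M\setminus\overline M'$ choose $i_\mu$, $1\le i_\mu<s$, with $\mathbf e_{l_{i_\mu}}=\mathbf e_{l_s}$ and $\mu=\mathbf M(i_\mu,s)$. Then $\mathfrak{GM}_*\cup\{\{i_\mu,s\}:\mu\in\overline M\setminus\overline M'\}$ is a restricted useful S-pair set for $G$.
   Context: **Ore extensions.** A multivariate Ore extension $\mathsf R=R[Y_1;\alpha_1,\delta_1]\cdots[Y_n;\alpha_n,\delta_n]$ of a domain $R$ is an iterated Ore extension ($Y_i\star r=\alpha_i(r)Y_i+\delta_i(r)$, $\alpha_i$ an injective ring endomorphism mapping $R$ to $R$, $\delta_i$ an $\alpha_i$-derivation mapping $R$ to $R$) such that $\alpha_j\delta_i=\delta_i\alpha_j$ for $i\ne j$, $\alpha_i\alpha_j=\alpha_j\alpha_i$, $\delta_i\delta_j=\delta_j\delta_i$, and $\alpha_j(Y_i)=Y_i$, $\delta_j(Y_i)=0$ for $i<j$. It is a free left $R$-module on the set of terms $\mathcal T=\{Y_1^{a_1}\cdots Y_n^{a_n}\}$, a commutative monoid. $\mathsf R^m$ has canonical basis $\mathbf e_1,\dots,\mathbf e_m$ and terms $\mathcal T^{(m)}=\{t\mathbf e_i\}$; a term ordering on $\mathcal T^{(m)}$ compatible with one on $\mathcal T$ is fixed; $\mathbf M(f)$ is the maximal monomial (leading coefficient times maximal term). **Restricted syzygies.** Let $E$ be the free left $R$-module on the symbols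 $e_\ell\rho$ ($1\le\ell\le u$, $\rho\in\mathcal T$), on which $\mathcal T$ acts on the right by $(a\,e_\ell\rho)\rho'=a\,e_\ell\rho\rho'$. Let $\mathfrak s_W:E\to\mathsf R^m$ be the left $R$-linear map $a\,e_\ell\rho\mapsto ac_\ell\,\tau_\ell\rho\,\mathbf e_{l_\ell}$. An element of $E$ is homogeneous if $\tau_\ell\rho\,\mathbf e_{l_\ell}$ is the same term for all $e_\ell\rho$ in its support. A restricted Gebauer–Möller set for $F$ is a set of homogeneous elements generating $\ker(\mathfrak s_W)$ under left multiplication by $R$, right multiplication by $\mathcal T$, and sums. **Notation.** For indices with equal $\mathbf e_{l_i}$: $\tau(i,j)=\mathrm{lcm}(\tau_i,\tau_j)$, $c(i,j)=c(j,i)=\mathrm{lcm}(c_i,c_j)$, $\tau(i,j,k)=\mathrm{lcm}(\tau_i,\tau_j,\tau_k)$, $c(i,j,k)=\mathrm{lcm}(c_i,c_j,c_k)$, $\mathbf M(i)=c_i\tau_i\mathbf e_{l_i}$, $\mathbf M(i,j)=c(i,j)\tau(i,j)\mathbf e_{l_i}$, $\mathbf M(i,j,k)=c(i,j,k)\tau(i,j,k)\mathbf e_{l_i}$, and $b_W(i,j)=\frac{c(i,j)}{c_j}e_j\frac{\tau(i,j)}{\tau_j}-\frac{c(i,j)}{c_i}e_i\frac{\tau(i,j)}{\tau_i}$. $c\tau\mathbf e_l\mid c'\tau'\mathbf e_{l'}$ means $l=l'$, $c\mid c'$, $\tau\mid\tau'$; (in)equalities between monomials $\mathbf M(\cdot)$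 are up to unit factors, lcm's being determined up to units. $c\tau\diamond c'\tau'=cc'\tau\tau'$ (for $m=1$). ''The ideal case'' is the case $m=1$ in which $\mathbb I_W(F)=\mathrm{Span}_R\{g\star\rho:g\in F,\rho\in\mathcal T\}$ is an ideal of $\mathsf R$; put $\mathfrak C_u=\{\{i,j\}:1\le i<j\le u,\ \mathbf M(i)\diamond\mathbf M(j)=\mathbf M(i,j)\}$ in the ideal case and $\mathfrak C_u=\emptyset$ otherwise, and similarly $\mathfrak C_s\subset\mathfrak C_u$, $\mathfrak C_{s-1}$ for the pairs of indices $\le s$, $\le s-1$. **Useful sets.** A restricted useful S-pair set for $F$ is a set $\mathfrak{GM}\subset\{\{i,j\}:1\le i<j\le u,\ \mathbf e_{l_i}=\mathbf e_{l_j}\}$ such that $\{b_W(i,j):\{i,j\}\in\mathfrak{GM}\cup\mathfrak C_u\}$ is a restricted Gebauer–Möller set for $F$ (for $G$ and $\{g_1,\dots,g_{s-1}\}$ use $\mathfrak C_s$, $\mathfrak C_{s-1}$). **Redundancy.** $\{i,j\}$, $i<j$, $\mathbf e_{l_i}=\mathbf e_{l_j}$, is redundant if either (a) there is $k>j$, $\mathbf e_{l_k}=\mathbf e_{l_i}$, with $\mathbf M(i,j,k)=\mathbf M(i,j)$ and $\mathbf M(i,k)\ne\mathbf M(i,j)\ne\mathbf M(j,k)$; or (b) there is $k<j$, $\mathbf e_{l_k}=\mathbf e_{l_i}$, with $\mathbf M(j,k)\mid\mathbf M(i,j)\ne\mathbf M(j,k)$. *)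

(* Defs.v *)
From HB Require Import structures.
From mathcomp Require Import all_boot all_order all_algebra.
From mathcomp.multinomials Require Import freeg mpoly.
From Stdlib Require Import ClassicalEpsilon.

Set Implicit Arguments.
Unset Strict Implicit.
Unset Printing Implicit Defensive.

Import GRing.Theory.

Local Open Scope ring_scope.

(* Ideals are Prop-valued subsets: no decidability of membership is assumed. *)
Definition two_sided_ideal (A : nzRingType) (I : A -> Prop) : Prop :=
  [/\ I 0,
      forall x y, I x -> I y -> I (x + y)
    & forall a x, I x -> I (a * x) /\ I (x * a)].

Definition dvdr (R : idomainType) (d a : R) : Prop := exists q, a = q * d.

Definition principal_ideal_domain (R : idomainType) : Prop :=
  forall I : R -> Prop, two_sided_ideal I ->
    exists d, forall x, I x <-> dvdr d x.

Definition is_lcm (R : idomainType) (s : seq R) (x : R) : Prop :=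
  forall y, dvdr x y <-> (forall a, a \in s -> dvdr a y).

(* The quotient a / b in R itself, meaningful when b != 0 divides a.  MathComp's
   a / b cannot be used: in an integral domain b^-1 = b when b is not a unit. *)
Definition exquo (R : idomainType) (a b : R) : R :=
  epsilon (inhabits 0) (fun q => a = q * b).

Definition is_subring (A : nzRingType) (S : A -> Prop) : Prop :=
  [/\ S 1,
      forall x y, S x -> S y -> S (x - y)
    & forall x y, S x -> S y -> S (x * y)].

(* S' = S[Y; alpha, delta], for subrings S and S' of an ambient ring A.  The
   maps alpha and delta are functions on A of which only the restriction to S
   matters.  Evaluation at Y of a polynomial over A puts coefficients on the
   left: p.[Y] is the sum of the p`_k * Y ^+ k. *)
Record ore_extension (A : nzRingType) (S S' : A -> Prop) (Y : A)
    (alpha delta : A -> A) : Prop := {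
  ore_sub_base : is_subring S;
  ore_sub_top : is_subring S';
  ore_incl : forall x, S x -> S' x;
  ore_var : S' Y;
  ore_alpha_stable : forall x, S x -> S (alpha x);
  ore_alpha1 : alpha 1 = 1;
  ore_alphaD : forall x y, S x -> S y -> alpha (x + y) = alpha x + alpha y;
  ore_alphaM : forall x y, S x -> S y -> alpha (x * y) = alpha x * alpha y;
  ore_alpha_inj : forall x y, S x -> S y -> alpha x = alpha y -> x = y;
  ore_delta_stable : forall x, S x -> S (delta x);
  ore_deltaD : forall x y, S x -> S y -> delta (x + y) = delta x + delta y;
  ore_deltaM : forall x y, S x -> S y ->
    delta (x * y) = alpha x * delta y + delta x * y;
  ore_comm : forall x, S x -> Y * x = alpha x * Y + delta x;
  ore_span : forall x, S' x ->
    exists2 p : {poly A}, (forall k, S p`_k) & x = p.[Y];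
  ore_free : forall p q : {poly A},
    (forall k, S p`_k) -> (forall k, S q`_k) -> p.[Y] = q.[Y] -> p = q
}.

(* mo_tower k is the intermediate ring R[Y_0; ...]...[Y_(k-1); ...], seen
   inside the final one. *)
Record multiOre (R : nzRingType) (n : nat) := MultiOre {
  mo_ring :> nzRingType;
  mo_C : {rmorphism R -> mo_ring};
  mo_Y : 'I_n -> mo_ring;
  mo_alpha : 'I_n -> mo_ring -> mo_ring;
  mo_delta : 'I_n -> mo_ring -> mo_ring;
  mo_tower : nat -> mo_ring -> Prop;
  mo_C_inj : injective mo_C;
  mo_tower0 : forall x, mo_tower 0 x <-> exists r, x = mo_C r;
  mo_towern : forall x, mo_tower n x;
  mo_step : forall i : 'I_n,
    ore_extension (mo_tower i) (mo_tower i.+1)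
                  (mo_Y i) (mo_alpha i) (mo_delta i);
  mo_alphaR : forall i r, exists r', mo_alpha i (mo_C r) = mo_C r';
  mo_deltaR : forall i r, exists r', mo_delta i (mo_C r) = mo_C r';
  (* The commutations are imposed on R, the common domain of all the alpha_i
     and delta_i; they then hold wherever both sides are defined, because of
     the values prescribed on the variables. *)
  mo_alpha_delta : forall i j r, i != j ->
    mo_alpha j (mo_delta i (mo_C r)) = mo_delta i (mo_alpha j (mo_C r));
  mo_alpha_alpha : forall i j r,
    mo_alpha i (mo_alpha j (mo_C r)) = mo_alpha j (mo_alpha i (mo_C r));
  mo_delta_delta : forall i j r,
    mo_delta i (mo_delta j (mo_C r)) = mo_delta j (mo_delta i (mo_C r));
  mo_alphaY : forall i j : 'I_n, (i < j)%N -> mo_alpha j (mo_Y i) = mo_Y i;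
  mo_deltaY : forall i j : 'I_n, (i < j)%N -> mo_delta j (mo_Y i) = 0
}.

(* The commutative monoid of terms is encoded by the exponents 'X_{1..n}, hence
   written additively, and the terms of the free module by 'X_{1..n} * 'I_m. *)
Definition term_order (n : nat) (leT : rel 'X_{1..n}) : Prop :=
  [/\ total leT, antisymmetric leT, transitive leT,
      forall t, leT 0%MM t
    & forall t t1 t2, leT t1 t2 -> leT (t + t1)%MM (t + t2)%MM].

Definition module_term_order (n m : nat) (leT : rel 'X_{1..n})
    (leM : rel ('X_{1..n} * 'I_m)) : Prop :=
  [/\ total leM, antisymmetric leM, transitive leM
    & forall t1 t2 w1 w2, leT t1 t2 -> leM w1 w2 ->
        leM ((t1 + w1.1)%MM, w1.2) ((t2 + w2.1)%MM, w2.2)].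

(* Mono c t l is the monomial c t e_l. *)
Record mono (R : nzRingType) (n m : nat) := Mono {
  mcf : R;
  mterm : 'X_{1..n};
  mpos : 'I_m
}.

Definition mono_dvd (R : idomainType) n m (M N : mono R n m) : Prop :=
  [/\ mpos M = mpos N, dvdr (mcf M) (mcf N) & (mterm M <= mterm N)%MM].

(* Equality of monomials up to a unit factor. *)
Definition mono_eq (R : idomainType) n m (M N : mono R n m) : Prop :=
  [/\ mpos M = mpos N, mterm M = mterm N
    & exists2 v, v \is a GRing.unit & mcf N = v * mcf M].

(* Only meaningful for m = 1, where the position carries no information. *)
Definition mono_mul (R : nzRingType) n m (M N : mono R n m) : mono R n m :=
  Mono (mcf M * mcf N) (mterm M + mterm N)%MM (mpos M).

Section OreModule.

Variables (R : nzRingType) (n m : nat) (O : multiOre R n).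

Definition ore_term (t : 'X_{1..n}) : O := \prod_(i < n) mo_Y O i ^+ t i.

Definition mod_mono (a : R) (w : 'X_{1..n} * 'I_m) : 'rV[O]_m :=
  (mo_C O a * ore_term w.1) *: delta_mx 0 w.2.

Definition is_max_mono (leM : rel ('X_{1..n} * 'I_m)) (f : 'rV[O]_m)
    (M : mono R n m) : Prop :=
  exists p : {freeg ('X_{1..n} * 'I_m) / R},
    [/\ f = \sum_(w <- dom p) mod_mono (coeff w p) w,
        (mterm M, mpos M) \in dom p,
        coeff (mterm M, mpos M) p = mcf M
      & forall w, w \in dom p -> leM w (mterm M, mpos M)].

Definition rmul_term (f : 'rV[O]_m) (t : 'X_{1..n}) : 'rV[O]_m :=
  map_mx (fun x => x * ore_term t) f.

Variables (u : nat) (g : 'I_u -> 'rV[O]_m).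

Inductive restricted_span : 'rV[O]_m -> Prop :=
| rspan0 : restricted_span 0
| rspanD : forall (a : R) (i : 'I_u) (t : 'X_{1..n}) (f : 'rV[O]_m),
    restricted_span f ->
    restricted_span (mo_C O a *: rmul_term (g i) t + f).

(* For m = 1, const_mx identifies O with O^m. *)
Definition ideal_case : Prop :=
  m = 1 /\ two_sided_ideal (fun x : O => restricted_span (const_mx x)).

End OreModule.

(* The free left R-module on the symbols e_l rho; the one attached to the first
   v elements of the family is its submodule syzmod_first v. *)
Notation syzmod R n u := {freeg ('I_u * 'X_{1..n}) / R}.

Section Syzygies.

Variables (R : nzRingType) (n u : nat).

Definition syz_act (x : syzmod R n u) (t : 'X_{1..n}) : syzmod R n u :=
  \sum_(k <- dom x) << coeff k x *g (k.1, (k.2 + t)%MM) >>.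

Definition syzmod_first (v : nat) (x : syzmod R n u) : Prop :=
  forall k, k \in dom x -> (k.1 < v)%N.

Inductive syz_span (B : syzmod R n u -> Prop) : syzmod R n u -> Prop :=
| sspan0 : syz_span B 0
| sspanD : forall (a : R) (b : syzmod R n u) (t : 'X_{1..n}) (x : syzmod R n u),
    B b -> syz_span B x -> syz_span B (a *: syz_act b t + x).

Variables (m : nat) (O : multiOre R n) (M : 'I_u -> mono R n m).

Definition syz_term (k : 'I_u * 'X_{1..n}) : 'X_{1..n} * 'I_m :=
  ((mterm (M k.1) + k.2)%MM, mpos (M k.1)).

Definition syz_map (x : syzmod R n u) : 'rV[O]_m :=
  \sum_(k <- dom x) mod_mono O (coeff k x * mcf (M k.1)) (syz_term k).

Definition syz_homogeneous (x : syzmod R n u) : Prop :=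
  forall k k', k \in dom x -> k' \in dom x -> syz_term k = syz_term k'.

Definition gebauer_moller (v : nat) (B : syzmod R n u -> Prop) : Prop :=
  (forall b, B b -> syzmod_first v b /\ syz_homogeneous b) /\
  (forall x, syz_span B x <-> syzmod_first v x /\ syz_map x = 0).

End Syzygies.

Section Pairs.

(* M i is the maximal monomial of g_i; c2 i j and c3 i j k are the chosen lcm's
   of the leading coefficients.  A set of pairs {i, j} with i < j is a relation
   contained in the strict order on indices. *)
Variables (R : idomainType) (n m u : nat) (O : multiOre R n).
Variables (g : 'I_u -> 'rV[O]_m) (M : 'I_u -> mono R n m).
Variables (c2 : 'I_u -> 'I_u -> R) (c3 : 'I_u -> 'I_u -> 'I_u -> R).

Definition tau2 (i j : 'I_u) : 'X_{1..n} := mlcm (mterm (M i)) (mterm (M j)).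

Definition tau3 (i j k : 'I_u) : 'X_{1..n} := mlcm (tau2 i j) (mterm (M k)).

Definition M2 (i j : 'I_u) : mono R n m := Mono (c2 i j) (tau2 i j) (mpos (M i)).

Definition M3 (i j k : 'I_u) : mono R n m :=
  Mono (c3 i j k) (tau3 i j k) (mpos (M i)).

Definition bW (i j : 'I_u) : syzmod R n u :=
    << exquo (c2 i j) (mcf (M j)) *g (j, (tau2 i j - mterm (M j))%MM) >>
  - << exquo (c2 i j) (mcf (M i)) *g (i, (tau2 i j - mterm (M i))%MM) >>.

Definition coprime_pair (i j : 'I_u) : Prop :=
  ideal_case g /\ mono_eq (mono_mul (M i) (M j)) (M2 i j).

(* The indices < v stand for the subfamily made of the first v elements. *)
Definition useful_pairs (v : nat) (GM : 'I_u -> 'I_u -> Prop) : Prop :=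
  (forall i j, GM i j -> [/\ (i < j)%N, (j < v)%N & mpos (M i) = mpos (M j)]) /\
  gebauer_moller O M v (fun b => exists i j : 'I_u,
    [/\ (i < j)%N, (j < v)%N, GM i j \/ coprime_pair i j & b = bW i j]).

Definition redundant (i j : 'I_u) : Prop :=
  (exists k : 'I_u,
     [/\ (j < k)%N, mpos (M k) = mpos (M i),
         mono_eq (M3 i j k) (M2 i j),
         ~ mono_eq (M2 i k) (M2 i j)
       & ~ mono_eq (M2 i j) (M2 j k)]) \/
  (exists k : 'I_u,
     [/\ (k < j)%N, mpos (M k) = mpos (M i),
         mono_dvd (M2 j k) (M2 i j)
       & ~ mono_eq (M2 i j) (M2 j k)]).

Definition Mbar (s : 'I_u) (mu : mono R n m) : Prop :=
  exists j : 'I_u, [/\ (j < s)%N, mpos (M j) = mpos (M s) & mu = M2 j s].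

Definition Mbar' (s : 'I_u) (mu : mono R n m) : Prop :=
  Mbar s mu /\
  ((exists nu, [/\ Mbar s nu, mono_dvd nu mu & ~ mono_eq mu nu]) \/
   (ideal_case g /\
    exists i : 'I_u,
      [/\ (i < s)%N, mono_eq (mono_mul (M i) (M s)) (M2 i s)
        & mono_eq (M2 i s) mu])).

End Pairs.

(* Main.v *)
(* The terms of an Ore extension are left independent over R (peel off the
   variables from the last one), so x is in the kernel of s_W if and only if, for
   every term w, the coefficients of x on the symbols mapped to w form a syzygy of
   the corresponding c_i.  In a principal ideal domain intersections of ideals
   distribute over sums, hence the component of such an x on the last symbol e_s
   can be cancelled with the b_W (i, s), i < s; by induction the b_W generate the
   kernel.  Finally, if M(k) divides M(i,j) then b_W (i, j) is a combination of
   b_W (i, k) and b_W (k, j), and induction on M(i,j) for divisibility, a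
   well-founded order because there are finitely many pairs, discards all the
   redundant pairs. *)

Require Import Defs.
From Stdlib Require Import ClassicalEpsilon.
From mathcomp Require Import all_boot all_order all_algebra.
From mathcomp.multinomials Require Import freeg mpoly.

Set Implicit Arguments.
Unset Strict Implicit.
Unset Printing Implicit Defensive.

Import GRing.Theory.

Local Open Scope ring_scope.

(** * Bezout combinations and distributivity in a principal ideal domain *)

Section Divisibility.

Variable R : idomainType.
Implicit Types a b c d : R.

Lemma dvdr_refl a : dvdr a a.
Proof. by exists 1; rewrite mul1r. Qed.

Lemma dvdr_trans b a c : dvdr a b -> dvdr b c -> dvdr a c.
Proof. by move=> [q ->] [r ->]; exists (r * q); rewrite mulrA. Qed.

Lemma exquoK a b : dvdr b a -> exquo a b * b = a.
Proof. by move=> /(epsilon_spec (inhabits 0)) <-. Qed.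

Lemma exquo_trans a b c :
  c != 0 -> dvdr c b -> dvdr b a -> exquo a b * exquo b c = exquo a c.
Proof.
move=> c0 cb ba; apply: (mulIf c0).
by rewrite -mulrA !exquoK //; apply: dvdr_trans ba.
Qed.

Lemma dvdr_antisym a b :
  dvdr a b -> dvdr b a -> exists2 v, v \is a GRing.unit & b = v * a.
Proof.
move=> [q bE] [r aE]; have [a0|a0] := eqVneq a 0.
  by exists 1; rewrite ?unitr1 // bE a0 !mulr0.
exists q => //; apply/unitrPr; exists r; apply: (mulIf a0).
by rewrite mul1r {2}aE bE mulrCA mulrA.
Qed.

Hypothesis pidR : principal_ideal_domain R.

(** The combinations of the [c i] form an ideal, and [d] is a generator of it. *)
Lemma pid_bezout (I : finType) (P : pred I) (c : I -> R) :
  exists d (x : I -> R),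
    d = \sum_(i | P i) x i * c i /\ forall i, P i -> dvdr d (c i).
Proof.
pose J y := exists x : I -> R, y = \sum_(i | P i) x i * c i.
have [|d dP] := pidR (I := J).
  split.
  - by exists (fun=> 0); rewrite big1 // => i _; rewrite mul0r.
  - move=> _ _ [x ->] [y ->]; exists (fun i => x i + y i).
    by rewrite -big_split; apply: eq_bigr => i _; rewrite mulrDl.
  - move=> a _ [x ->]; have h : J (a * (\sum_(i | P i) x i * c i)).
    exists (fun i => a * x i); rewrite big_distrr.
    by apply: eq_bigr => i _; rewrite /= mulrA.
  by split; rewrite // mulrC.
have [x dE] := (dP d).2 (dvdr_refl d).
exists d, x; split=> // i Pi; apply/dP; exists (fun j => (j == i)%:R).
rewrite (bigD1 i) //= eqxx mul1r big1 ?addr0 // => j /andP[_ /negPf->].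
by rewrite mul0r.
Qed.

(* Intersecting ideals distributes over adding them: (sum_i (c i)) meets (b)
   in sum_i ((c i) meets (b)). *)
Lemma pid_distrib (I : finType) (P : pred I) (c a : I -> R) b :
  dvdr b (\sum_(i | P i) a i * c i) ->
  exists f : I -> R,
    \sum_(i | P i) a i * c i = \sum_(i | P i) f i /\
    forall i, P i -> dvdr (c i) (f i) /\ dvdr b (f i).
Proof.
set e := \sum_(i | P i) _ => be; have [d [x [dE dc]]] := pid_bezout P c.
pose q i := exquo (c i) d.
have qE i : P i -> c i = q i * d by move=> /dc /exquoK->.
have eE : e = (\sum_(i | P i) a i * q i) * d.
  by rewrite big_distrl; apply: eq_bigr => i Pi; rewrite /= -mulrA -qE.
have [d0|d0] := eqVneq d 0.
  exists (fun=> 0); rewrite big1_eq eE d0 mulr0; split=> // i _.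
  by split; exists 0; rewrite mul0r.
(* The cofactors satisfy [\sum_i x i * q i = 1], so these multiples of [e] add up to [e]. Each is
   divisible by [b], as [e] is, and by [c i = q i * d], because [d] divides [e]. *)
exists (fun i => x i * q i * e); split=> [|i Pi].
  rewrite -big_distrl /=; have -> : \sum_(i | P i) x i * q i = 1.
    apply: (mulIf d0); rewrite mul1r {2}dE big_distrl.
    by apply: eq_bigr => i Pi; rewrite /= -mulrA -qE.
  by rewrite mul1r.
split; last by apply: dvdr_trans be _; exists (x i * q i).
rewrite eE; set h := \sum_(j | P j) _.
by exists (x i * h); rewrite qE // mulrACA.
Qed.

End Divisibility.

(** * Left independence of the terms of an Ore extension *)

Lemma subring_sum (A : nzRingType) (S : A -> Prop) (I : Type) (r : seq I)
    (P : pred I) (F : I -> A) :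
  is_subring S -> (forall i, P i -> S (F i)) -> S (\sum_(i <- r | P i) F i).
Proof.
move=> [S1 SB _] SF; have S0 : S 0 by rewrite -(subrr 1); apply: SB.
apply: big_ind => // x y Sx Sy; rewrite -[y]opprK; apply: (SB) => //.
by rewrite -sub0r; apply: SB.
Qed.

Lemma subring_prod (A : nzRingType) (S : A -> Prop) (I : Type) (r : seq I)
    (P : pred I) (F : I -> A) :
  is_subring S -> (forall i, P i -> S (F i)) -> S (\prod_(i <- r | P i) F i).
Proof. by move=> [S1 _ SM] SF; apply: big_ind. Qed.

Lemma subring_exp (A : nzRingType) (S : A -> Prop) x k :
  is_subring S -> S x -> S (x ^+ k).
Proof.
move=> [S1 _ SM] Sx; elim: k => [|k IH]; first by rewrite expr0.
by rewrite exprS; apply: SM.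
Qed.

Section OreFree.

Variables (R : nzRingType) (n m : nat) (O : multiOre R n).

Lemma tower_subring k : (k < n)%N -> is_subring (@mo_tower _ _ O k).
Proof. by move=> kn; have [] := mo_step O (Ordinal kn). Qed.

Lemma tower_le k l x :
  (k <= l)%N -> (l <= n)%N -> @mo_tower _ _ O k x -> @mo_tower _ _ O l x.
Proof.
elim: l => [|l IH]; first by rewrite leqn0 => /eqP->.
rewrite leq_eqVlt => /predU1P[-> //|kl] ln Skx.
by apply: (ore_incl (mo_step O (Ordinal ln))); apply: IH => //; apply: ltnW.
Qed.

Definition pterm k (t : 'X_{1..n}) : O :=
  \prod_(i < n | (i < k)%N) mo_Y O i ^+ t i.

Lemma pterm_tower k t : (k < n)%N -> @mo_tower _ _ O k (pterm k t).
Proof.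
move=> kn; have Sk := tower_subring kn.
apply: subring_prod => // i ik; apply: subring_exp => //.
by apply: (tower_le ik (ltnW kn)); apply: (ore_var (mo_step O i)).
Qed.

Lemma ptermS (k : 'I_n) t : pterm k.+1 t = pterm k t * mo_Y O k ^+ t k.
Proof.
rewrite /pterm (big_ord_narrow (ltn_ord k)) big_ord_recr /=.
rewrite (big_ord_narrow (ltnW (ltn_ord k))); congr (_ * _).
  by apply: eq_bigr => i _; congr (mo_Y O _ ^+ t _); apply: val_inj.
by congr (mo_Y O _ ^+ t _); apply: val_inj.
Qed.

Lemma pterm_n t : pterm n t = ore_term O t.
Proof. by apply: eq_bigl => i; rewrite ltn_ord. Qed.

(** Grouping by the exponent of the last variable presents the sum as the value of a polynomial over
    the lower ring; its coefficients vanish and are relations in fewer variables. The hypothesis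
    that the first [k] exponents separate the terms of [s] survives the restriction to one
    exponent. *)
Lemma pterm_free k (a : 'X_{1..n} -> R) (s : seq 'X_{1..n}) :
    (k <= n)%N -> uniq s ->
    (forall t t' : 'X_{1..n}, t \in s -> t' \in s ->
       (forall i : 'I_n, (i < k)%N -> t i = t' i) -> t = t') ->
  \sum_(t <- s) mo_C O (a t) * pterm k t = 0 ->
  forall t, t \in s -> a t = 0.
Proof.
elim: k s => [|k IH] s kn us inj_s s0 t ts.
  (* With no variable left, separation reduces [s] to the single term [t]. *)
  have sE : perm_eq s [:: t].
    apply: uniq_perm => // t'; rewrite inE; apply/idP/eqP => [t's|-> //].
    exact: inj_s.
  move: s0; rewrite (perm_big _ sE) big_seq1 /pterm big1 // mulr1.
  by rewrite -[RHS](rmorph0 (mo_C O)) => /(@mo_C_inj _ _ O).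
pose ik := Ordinal kn; have step := mo_step O ik.
have Sk := tower_subring kn.
pose p : {poly O} := \sum_(t <- s) (mo_C O (a t) * pterm k t) *: 'X^(t ik).
have pE j : p`_j = \sum_(t <- s | t ik == j) mo_C O (a t) * pterm k t.
  rewrite coef_sum [RHS]big_mkcond; apply: eq_bigr => t' _ /=.
  by rewrite coefZ coefXn eq_sym; case: eqP => _; rewrite ?mulr1 ?mulr0.
have p0 : p = 0.
  apply: (ore_free step) => [j|j|].
  - rewrite pE; apply: subring_sum => // t' _; have [_ _ SM] := Sk.
    apply: SM; last exact: pterm_tower.
    by apply: (tower_le (leq0n k) (ltnW kn)); apply/mo_tower0; exists (a t').
  - by rewrite coef0; have [S1 SB _] := Sk; rewrite -(subrr 1); apply: SB.
  rewrite horner0 -s0 horner_sum; apply: eq_bigr => t' _.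
  by rewrite hornerZ hornerXn (ptermS ik) mulrA.
(* The terms sharing with [t] the exponent of the last variable add up to one coefficient of [p]. *)
apply: (IH [seq t' : 'X_{1..n} <- s | t' ik == t ik]);
  rewrite ?mem_filter ?eqxx //.
- exact: ltnW.
- exact: filter_uniq.
- move=> t1 t2; rewrite !mem_filter => /andP[/eqP e1 s1] /andP[/eqP e2 s2] e12.
  apply: inj_s => // i; rewrite ltnS leq_eqVlt => /predU1P[ik'|/e12 //].
  by have -> : i = ik by [apply: val_inj]; rewrite e1 e2.
by rewrite big_filter -pE p0 coef0.
Qed.

Lemma ore_term_free (a : 'X_{1..n} -> R) s : uniq s ->
  \sum_(t <- s) mo_C O (a t) * ore_term O t = 0 ->
  forall t, t \in s -> a t = 0.
Proof.
move=> us s0; apply: (@pterm_free n) => // [t t' _ _ tt'|].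
  by apply/mnmP => i; apply: tt'.
by rewrite -[RHS]s0; apply: eq_bigr => t _; rewrite pterm_n.
Qed.

(** Coordinate [l] of the sum sees only the terms in position [l]. *)
Lemma mod_mono_free (a : 'X_{1..n} * 'I_m -> R) s : uniq s ->
  \sum_(w <- s) mod_mono O (a w) w = 0 -> forall w, w \in s -> a w = 0.
Proof.
move=> us /matrixP s0 [t l] ws.
apply: (ore_term_free (a := fun t => a (t, l))
                     (s := [seq w.1 | w <- s & w.2 == l])).
- rewrite map_inj_in_uniq ?filter_uniq // => -[t1 l1] [t2 l2].
  by rewrite !mem_filter /= => /andP[/eqP-> _] /andP[/eqP-> _] ->.
- have := s0 0 l; rewrite summxE mxE => {2}<-.
  rewrite big_map big_filter big_mkcond; apply: eq_bigr => -[t' l'] _ /=.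
  by rewrite !mxE eqxx eq_sym /=; case: eqP => [->|_]; rewrite ?mulr1 ?mulr0.
by apply/mapP; exists (t, l); rewrite // mem_filter eqxx.
Qed.

Lemma mod_monoB a b (w : 'X_{1..n} * 'I_m) :
  mod_mono O (a - b) w = mod_mono O a w - mod_mono O b w.
Proof. by rewrite /mod_mono rmorphB mulrBl scalerBl. Qed.

Lemma mod_monoM a b (w : 'X_{1..n} * 'I_m) :
  mod_mono O (a * b) w = mo_C O a *: mod_mono O b w.
Proof. by rewrite /mod_mono rmorphM -mulrA scalerA. Qed.

End OreFree.

(** * Sums over the support of a formal combination *)

Section DomSum.

Variables (R : nzRingType) (K : choiceType) (V : zmodType) (F : K -> R -> V).
Hypothesis F_sub : forall k a b, F k (a - b) = F k a - F k b.
Implicit Types D : {freeg K / R}.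

(** Common shape of [syz_act] and [syz_map]. As [F] is additive in the coefficient, symbols outside
    the support contribute 0, so two supports can be enlarged to a common list. *)
Definition dom_sum D := \sum_(k <- dom D) F k (coeff k D).

Lemma dom_sum_F0 k : F k 0 = 0.
Proof. by have := F_sub k 0 0; rewrite !subrr. Qed.

Lemma dom_sum_widen D s :
  uniq s -> {subset dom D <= s} -> dom_sum D = \sum_(k <- s) F k (coeff k D).
Proof.
move=> us Ds; rewrite [RHS](bigID (mem (dom D))) /= [X in _ + X]big1 ?addr0.
  rewrite -big_filter; apply: perm_big; apply: uniq_perm.
  - exact: uniq_dom.
  - exact: filter_uniq.
  move=> k; rewrite mem_filter andb_idr //; exact: Ds.
by move=> k /coeff_outdom->; rewrite dom_sum_F0.
Qed.

Lemma dom_sumB D1 D2 : dom_sum (D1 - D2) = dom_sum D1 - dom_sum D2.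
Proof.
pose s := undup (dom D1 ++ dom D2).
have us : uniq s by apply: undup_uniq.
rewrite !(@dom_sum_widen _ s) // => [|k kD|k kD|k /domB].
- by rewrite -sumrB; apply: eq_bigr => k _; rewrite coeffB F_sub.
- by rewrite mem_undup mem_cat kD orbT.
- by rewrite mem_undup mem_cat kD.
by rewrite mem_undup.
Qed.

Lemma dom_sum0 : dom_sum 0 = 0.
Proof. by rewrite /dom_sum dom0 big_nil. Qed.

Lemma dom_sumD D1 D2 : dom_sum (D1 + D2) = dom_sum D1 + dom_sum D2.
Proof.
have := dom_sumB D1 (0 - D2).
by rewrite (dom_sumB 0) dom_sum0 !sub0r !opprK.
Qed.

Lemma dom_sumU a k : dom_sum << a *g k >> = F k a.
Proof.
have [->|a0] := eqVneq a 0; last first.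
  by rewrite /dom_sum domU // big_seq1 coeffU eqxx mulr1.
by rewrite freegU0 /dom_sum dom0 big_nil dom_sum_F0.
Qed.

(** [G] is the action of [a] on the target: scaling by [a] for [syz_act], by [mo_C O a] for
    [syz_map]. *)
Lemma dom_sumZ (G : V -> V) a D :
    {morph G : x y / x + y} -> G 0 = 0 ->
  (forall k b, F k (a * b) = G (F k b)) -> dom_sum (a *: D) = G (dom_sum D).
Proof.
move=> GD G0 FG; rewrite (@dom_sum_widen _ (dom D)) ?uniq_dom //; last first.
  exact: domZ_subset.
rewrite /dom_sum (big_morph G GD G0).
by apply: eq_bigr => k _; rewrite coeffZ FG.
Qed.

End DomSum.

(** * The syzygy module, its spans and its map to the Ore module *)

Section Syz.

Variables (R : nzRingType) (n u : nat).
Implicit Types (x y : syzmod R n u) (k : 'I_u * 'X_{1..n}) (t : 'X_{1..n}).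

Lemma scale_freegU a b k :
  a *: << b *g k >> = << a * b *g k >> :> syzmod R n u.
Proof. by apply/eqP/freeg_eqP => l; rewrite coeffZ !coeffU mulrA. Qed.

Let act_term t k a : syzmod R n u := << a *g (k.1, (k.2 + t)%MM) >>.

Lemma syz_actB x y t : syz_act (x - y) t = syz_act x t - syz_act y t.
Proof.
by apply: (dom_sumB (F := act_term t)) => k a b;
  rewrite /act_term freegUB.
Qed.

Lemma syz_actD x y t : syz_act (x + y) t = syz_act x t + syz_act y t.
Proof.
by apply: (dom_sumD (F := act_term t)) => k a b;
  rewrite /act_term freegUB.
Qed.

Lemma syz_act0 t : syz_act (0 : syzmod R n u) t = 0.
Proof. by rewrite /syz_act dom0 big_nil. Qed.

Lemma syz_actU a k t :
  syz_act << a *g k >> t = << a *g (k.1, (k.2 + t)%MM) >> :> syzmod R n u.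
Proof.
by apply: (dom_sumU (F := act_term t)) => l b c;
  rewrite /act_term freegUB.
Qed.

Lemma syz_actZ a x t : syz_act (a *: x) t = a *: syz_act x t.
Proof.
apply: (dom_sumZ (F := act_term t)) => [l b c|y z||l b];
  rewrite /act_term ?freegUB ?scalerDr ?scaler0 //.
by rewrite scale_freegU.
Qed.

Lemma syz_actA x t t' : syz_act (syz_act x t) t' = syz_act x (t + t')%MM.
Proof.
rewrite {2}/syz_act (big_morph (fun y => syz_act y t') (id1 := 0) (op1 := +%R)).
- by apply: eq_bigr => k _; rewrite syz_actU addmA.
- by move=> y z; apply: syz_actD.
exact: syz_act0.
Qed.

Lemma syz_actm0 x : syz_act x 0%MM = x.
Proof.
by rewrite -[RHS]freeg_sumE; apply: eq_bigr => -[i t] _; rewrite addm0.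
Qed.

Lemma syz_firstP v x :
  syzmod_first v x <-> forall k, (v <= k.1)%N -> coeff k x = 0.
Proof.
split=> [xv k vk|xv k].
  by apply: coeff_outdom; apply: contraL vk => /xv; rewrite -ltnNge.
by rewrite mem_dom ltnNge; apply: contraNN => /xv->.
Qed.

Lemma syz_firstB v x y :
  syzmod_first v x -> syzmod_first v y -> syzmod_first v (x - y).
Proof.
move=> /syz_firstP xv /syz_firstP yv; apply/syz_firstP => k vk.
by rewrite coeffB xv ?yv ?subrr.
Qed.

Lemma syz_firstD v x y :
  syzmod_first v x -> syzmod_first v y -> syzmod_first v (x + y).
Proof.
move=> /syz_firstP xv /syz_firstP yv; apply/syz_firstP => k vk.
by rewrite coeffD xv ?yv ?addr0.
Qed.

Lemma syz_firstZ v a x : syzmod_first v x -> syzmod_first v (a *: x).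
Proof.
move=> /syz_firstP xv; apply/syz_firstP => k vk.
by rewrite coeffZ xv ?mulr0.
Qed.

Lemma syz_firstU v (a : R) k :
  (k.1 < v)%N -> syzmod_first v (<< a *g k >> : syzmod R n u).
Proof.
move=> kv; apply/syz_firstP => l vl; rewrite coeffU.
by case: eqP kv => [->|_ _]; rewrite ?mulr0 // ltnNge vl.
Qed.

Lemma syz_first_act v x t : syzmod_first v x -> syzmod_first v (syz_act x t).
Proof.
move=> xv; rewrite /syz_act big_seq.
apply: big_ind => [k|y z yv zv|k /xv kv]; first by rewrite dom0.
  exact: syz_firstD.
exact: syz_firstU.
Qed.

Variable B : syzmod R n u -> Prop.

Lemma syz_spanD x y : syz_span B x -> syz_span B y -> syz_span B (x + y).
Proof.
move=> xB yB; elim: xB => [|a b t z bB _ IH]; first by rewrite add0r.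
by rewrite -addrA; apply: sspanD.
Qed.

Lemma syz_spanZ a x : syz_span B x -> syz_span B (a *: x).
Proof.
elim=> [|c b t z bB _ IH]; first by rewrite scaler0; apply: sspan0.
by rewrite scalerDr scalerA; apply: sspanD.
Qed.

Lemma syz_spanN x : syz_span B x -> syz_span B (- x).
Proof. by rewrite -scaleN1r; apply: syz_spanZ. Qed.

Lemma syz_span_act x t : syz_span B x -> syz_span B (syz_act x t).
Proof.
elim=> [|c b t' z bB _ IH]; first by rewrite syz_act0; apply: sspan0.
by rewrite syz_actD syz_actZ syz_actA; apply: sspanD.
Qed.

Lemma syz_span_gen b : B b -> syz_span B b.
Proof.
move=> bB; have := sspanD 1 0%MM bB (sspan0 B).
by rewrite scale1r addr0 syz_actm0.
Qed.

Lemma syz_span_trans (B' : syzmod R n u -> Prop) x :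
  (forall b, B' b -> syz_span B b) -> syz_span B' x -> syz_span B x.
Proof.
move=> B'B; elim=> [|a b t y /B'B bB _ IH]; first exact: sspan0.
by apply: syz_spanD IH; apply: syz_spanZ; apply: syz_span_act.
Qed.

Variables (m : nat) (O : multiOre R n) (M : 'I_u -> mono R n m).

Let map_term k a := mod_mono O (a * mcf (M k.1)) (syz_term M k).

Let map_term_sub k a b : map_term k (a - b) = map_term k a - map_term k b.
Proof. by rewrite /map_term mulrBl mod_monoB. Qed.

Lemma syz_map0 : syz_map O M 0 = 0.
Proof. by rewrite /syz_map dom0 big_nil. Qed.

Lemma syz_mapB x y : syz_map O M (x - y) = syz_map O M x - syz_map O M y.
Proof. by apply: (dom_sumB (F := map_term)) => k a b; apply: map_term_sub. Qed.

Lemma syz_mapD x y : syz_map O M (x + y) = syz_map O M x + syz_map O M y.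
Proof. by apply: (dom_sumD (F := map_term)) => k a b; apply: map_term_sub. Qed.

Lemma syz_mapU a k :
  syz_map O M << a *g k >> = mod_mono O (a * mcf (M k.1)) (syz_term M k).
Proof. by apply: (dom_sumU (F := map_term)) => l b c; apply: map_term_sub. Qed.

Lemma syz_mapZ a x : syz_map O M (a *: x) = mo_C O a *: syz_map O M x.
Proof.
apply: (dom_sumZ (F := map_term)) => [k b c|y z||k b].
- exact: map_term_sub.
- exact: scalerDr.
- exact: scaler0.
by rewrite /map_term -mulrA mod_monoM.
Qed.

(** The sum is the coefficient of the image at [T] in position [l], zero by independence: for each
    admissible [i], the only symbol over [i] sent there has exponent [T - mterm (M i)]. *)
Lemma syz_map_coord x (T : 'X_{1..n}) (l : 'I_m) :
  syz_map O M x = 0 ->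
  \sum_(i | (mpos (M i) == l) && (mterm (M i) <= T)%MM)
     coeff (i, (T - mterm (M i))%MM) x * mcf (M i) = 0.
Proof.
move=> x0; pose w := (T, l).
pose a (w' : 'X_{1..n} * 'I_m) :=
  \sum_(k <- dom x | syz_term M k == w') coeff k x * mcf (M k.1).
(* Adjoining [w] covers the case where no symbol of [x] is sent to [w]. *)
pose s : seq ('X_{1..n} * 'I_m) := undup (w :: [seq syz_term M k | k <- dom x]).
have aw : a w = 0.
  apply: (@mod_mono_free _ _ _ O a s (undup_uniq _)); last first.
    by rewrite mem_undup mem_head.
  have mod_mono0 (w' : 'X_{1..n} * 'I_m) : mod_mono O 0 w' = 0.
    by rewrite /mod_mono rmorph0 mul0r scale0r.
  have mod_monoD (w' : 'X_{1..n} * 'I_m) :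
    {morph (mod_mono O)^~ w' : y z / y + z}.
    by move=> y z; rewrite /mod_mono rmorphD mulrDl scalerDl.
  rewrite -[RHS]x0 /syz_map.
  under eq_bigr => w' _ do
    rewrite /a (big_morph _ (mod_monoD w') (mod_mono0 w')).
  rewrite (exchange_big_dep xpredT) //= big_seq [RHS]big_seq.
  apply: eq_bigr => k kx; under eq_bigl => w' do rewrite eq_sym.
  rewrite -big_filter filter_pred1_uniq ?undup_uniq ?big_seq1 //.
  by rewrite mem_undup inE map_f ?orbT.
have xE k' : coeff k' x = \sum_(k <- dom x) coeff k x * (k == k')%:R.
  rewrite -{1}[x]freeg_sumE raddf_sum.
  by apply: eq_bigr => k _; apply: coeffU.
rewrite -[RHS]aw /a [RHS]big_mkcond /=.
under eq_bigr => i _ do rewrite xE big_distrl /=.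
(* A symbol [(j, r)] sent to [w] contributes once, at [i = j]; any other contributes nothing. *)
rewrite exchange_big /=; apply: eq_bigr => -[j r] _; rewrite /syz_term /=.
case: eqP => [[jT jl]|jw].
  rewrite (bigD1 j) /=; last by rewrite jl eqxx -jT lem_addr.
  rewrite -jT addmC addmK eqxx mulr1 big1 ?addr0 // => i /andP[_ ij].
  by rewrite xpair_eqE eq_sym (negPf ij) mulr0 mul0r.
apply: big1 => i /andP[/eqP il iT].
case: eqP => [[ji rT]|_]; last by rewrite mulr0 mul0r.
by case: jw; rewrite ji rT il addmC submK.
Qed.

End Syz.

(** * Divisibility of monomials and equality up to units *)

Section Monomials.

Variables (R : idomainType) (n m : nat).
Implicit Types L M N : mono R n m.

Lemma mono_dvd_refl M : mono_dvd M M.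
Proof. by split; [|apply: dvdr_refl|apply: lepm_refl]. Qed.

Lemma mono_dvd_trans L M N : mono_dvd L M -> mono_dvd M N -> mono_dvd L N.
Proof.
move=> [pLM cLM tLM] [pMN cMN tMN]; split; first by rewrite pLM.
  exact: dvdr_trans cLM cMN.
exact: lepm_trans tLM tMN.
Qed.

Lemma mono_dvd_antisym M N : mono_dvd M N -> mono_dvd N M -> mono_eq M N.
Proof.
move=> [pMN cMN tMN] [_ cNM tNM]; split=> //; last exact: dvdr_antisym.
apply/mnmP => i; apply/eqP; rewrite eqn_leq.
by rewrite (mnm_lepP tMN) (mnm_lepP tNM).
Qed.

Lemma mono_eq_dvd M N : mono_eq M N -> mono_dvd M N.
Proof.
by move=> [pMN tMN [v _ cN]]; split; rewrite ?tMN ?lepm_refl //; exists v.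
Qed.

Lemma mono_eq_sym M N : mono_eq M N -> mono_eq N M.
Proof.
move=> [pMN tMN [v vU cN]]; split=> //; exists v^-1; first by rewrite unitrV.
by rewrite cN mulKr.
Qed.

End Monomials.

(** * Pair syzygies as differences of lifts *)

Section PairSyzygies.

Variables (R : idomainType) (n m u : nat) (O : multiOre R n).
Variables (M : 'I_u -> mono R n m) (c2 : 'I_u -> 'I_u -> R).
Hypothesis M_neq0 : forall i, mcf (M i) != 0.
Hypothesis c2P : forall i j, mpos (M i) = mpos (M j) ->
  is_lcm [:: mcf (M i); mcf (M j)] (c2 i j).
Hypothesis c2C : forall i j, c2 i j = c2 j i.
Implicit Types (i j s : 'I_u) (x y b : syzmod R n u) (T : 'X_{1..n}).
Implicit Types B : syzmod R n u -> Prop.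

Local Notation bW := (bW M c2).
Local Notation M2 := (M2 M c2).
Local Notation tau2 := (tau2 M).

(* The multiple of e_i that s_W sends to f T e_l, for f divisible by c_i. *)
Definition lift_elt (f : R) T i : syzmod R n u :=
  << exquo f (mcf (M i)) *g (i, (T - mterm (M i))%MM) >>.

Lemma c2_lcm i j f : mpos (M i) = mpos (M j) ->
  dvdr (c2 i j) f <-> dvdr (mcf (M i)) f /\ dvdr (mcf (M j)) f.
Proof.
move=> pij; split=> [/(c2P pij) h|[hi hj]].
  by split; apply: h; rewrite !inE eqxx ?orbT.
by apply/(c2P pij) => a; rewrite !inE => /pred2P[]->.
Qed.

Lemma c2_dvdl i j : mpos (M i) = mpos (M j) -> dvdr (mcf (M i)) (c2 i j).
Proof. by move=> pij; case/(c2_lcm _ pij): (dvdr_refl (c2 i j)). Qed.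

Lemma c2_dvdr i j : mpos (M i) = mpos (M j) -> dvdr (mcf (M j)) (c2 i j).
Proof. by move=> pij; case/(c2_lcm _ pij): (dvdr_refl (c2 i j)). Qed.

Lemma tau2C i j : tau2 i j = tau2 j i.
Proof. exact: mlcmC. Qed.

Lemma bWE i j :
  bW i j = lift_elt (c2 i j) (tau2 i j) j - lift_elt (c2 i j) (tau2 i j) i.
Proof. by []. Qed.

Lemma bW_sym i j : bW j i = - bW i j.
Proof. by rewrite !bWE opprB c2C tau2C. Qed.

Lemma bW_diag i : bW i i = 0.
Proof. exact: subrr. Qed.

Lemma lift_elt_mul i f0 f T0 T :
    dvdr (mcf (M i)) f0 -> dvdr f0 f ->
    (mterm (M i) <= T0)%MM -> (T0 <= T)%MM ->
  exquo f f0 *: syz_act (lift_elt f0 T0 i) (T - T0)%MM = lift_elt f T i.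
Proof.
move=> cf0 f0f iT0 T0T.
rewrite syz_actU scale_freegU exquo_trans //; congr << _ *g (i, _) >>.
apply/mnmP => l; rewrite !mnmE addnC addnBA ?subnK //.
  exact: (mnm_lepP T0T).
exact: (mnm_lepP iT0).
Qed.

(** Rescaling from [M2 i j] to a common multiple turns [bW i j] into a difference of two lifts; such
    differences telescope. *)
Lemma bW_mul i j f T : mpos (M i) = mpos (M j) ->
    dvdr (mcf (M i)) f -> dvdr (mcf (M j)) f ->
    (mterm (M i) <= T)%MM -> (mterm (M j) <= T)%MM ->
  exquo f (c2 i j) *: syz_act (bW i j) (T - tau2 i j)%MM =
    lift_elt f T j - lift_elt f T i.
Proof.
move=> pij fi fj Ti Tj; have cf : dvdr (c2 i j) f by apply/c2_lcm.
have tT : (tau2 i j <= T)%MM by rewrite lem_mlcm Ti Tj.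
rewrite bWE syz_actB scalerBr !lift_elt_mul //.
- exact: c2_dvdl.
- exact: lem_mlcml.
- exact: c2_dvdr.
exact: lem_mlcmr.
Qed.

Lemma lift_elt_span B i j f T : mpos (M i) = mpos (M j) ->
    dvdr (mcf (M i)) f -> dvdr (mcf (M j)) f ->
    (mterm (M i) <= T)%MM -> (mterm (M j) <= T)%MM ->
  syz_span B (bW i j) -> syz_span B (lift_elt f T j - lift_elt f T i).
Proof.
move=> pij fi fj Ti Tj Bij; rewrite -bW_mul //.
by apply: syz_spanZ; apply: syz_span_act.
Qed.

(** The lift of [M2 i j] at [k] is inserted between those at [i] and [j]; the two differences are
    multiples of [bW i k] and [bW k j]. *)
Lemma bW_exchange B i j k :
    mpos (M i) = mpos (M j) -> mono_dvd (M k) (M2 i j) ->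
  syz_span B (bW i k) -> syz_span B (bW k j) -> syz_span B (bW i j).
Proof.
move=> pij [/= pki ck tk] Bik Bkj.
rewrite bWE -(subrKA (lift_elt (c2 i j) (tau2 i j) k)).
have [ci cj] := (c2_dvdl pij, c2_dvdr pij).
have ti : (mterm (M i) <= tau2 i j)%MM by apply: lem_mlcml.
have tj : (mterm (M j) <= tau2 i j)%MM by apply: lem_mlcmr.
by apply: syz_spanD; apply: lift_elt_span; rewrite // pki.
Qed.

Lemma M2_sym i j : mpos (M i) = mpos (M j) -> M2 i j = M2 j i.
Proof. by move=> pij; rewrite /Defs.M2 c2C tau2C pij. Qed.

Lemma mono_dvd_M2l i j : mpos (M i) = mpos (M j) -> mono_dvd (M i) (M2 i j).
Proof. by move=> pij; split; [|apply: c2_dvdl|apply: lem_mlcml]. Qed.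

Lemma mono_dvd_M2r i j : mpos (M i) = mpos (M j) -> mono_dvd (M j) (M2 i j).
Proof. by move=> pij; rewrite M2_sym //; apply: mono_dvd_M2l. Qed.

Lemma M2_dvd i j N :
  mono_dvd (M i) N -> mono_dvd (M j) N -> mono_dvd (M2 i j) N.
Proof.
move=> [pi ci ti] [pj cj tj]; split=> //; last by rewrite lem_mlcm ti tj.
by apply/c2_lcm; rewrite ?pi ?pj.
Qed.

Lemma bW_homogeneous i j : mpos (M i) = mpos (M j) ->
  syz_homogeneous M (bW i j).
Proof.
move=> pij; have bWt (k : 'I_u * 'X_{1..n}) : k \in dom (bW i j) ->
    syz_term M k = (tau2 i j, mpos (M i)).
  move=> /domB; rewrite mem_cat !mem_dom !coeffU.
  have [<- _|_] := eqVneq (j, (tau2 i j - mterm (M j))%MM) k.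
    by rewrite /syz_term /= addmC submK ?pij // lem_mlcmr.
  have [<- _|_] := eqVneq (i, (tau2 i j - mterm (M i))%MM) k.
    by rewrite /syz_term /= addmC submK // lem_mlcml.
  by rewrite !mulr0 eqxx.
by move=> k k' /bWt-> /bWt->.
Qed.

Lemma bW_first v i j : (i < v)%N -> (j < v)%N -> syzmod_first v (bW i j).
Proof. by move=> iv jv; apply: syz_firstB; apply: syz_firstU. Qed.

Lemma syz_map_bW_act i j T : mpos (M i) = mpos (M j) ->
  syz_map O M (syz_act (bW i j) T) = 0.
Proof.
move=> pij; rewrite syz_actB syz_mapB !syz_actU !syz_mapU /syz_term /=.
rewrite !addmA !(addmC (mterm _)) !submK ?lem_mlcml ?lem_mlcmr //.
by rewrite !exquoK ?pij ?subrr //; [apply: c2_dvdl|apply: c2_dvdr].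
Qed.

Definition pair_syzygies (v : nat) B := forall b, B b ->
  exists i j, [/\ (i < v)%N, (j < v)%N, mpos (M i) = mpos (M j) & b = bW i j].

Lemma pair_syzygies_sound v B x : pair_syzygies v B ->
  syz_span B x -> syzmod_first v x /\ syz_map O M x = 0.
Proof.
move=> hB; elim=> [|a b T y /hB[i [j [iv jv pij ->]]] _ [yv y0]].
  by split; [move=> k; rewrite dom0|rewrite syz_map0].
split; first by apply: syz_firstD yv; apply/syz_firstZ/syz_first_act/bW_first.
by rewrite syz_mapD syz_mapZ syz_map_bW_act // scaler0 add0r.
Qed.

Lemma gebauer_moller_intro v B : pair_syzygies v B ->
    (forall x, syzmod_first v x -> syz_map O M x = 0 -> syz_span B x) ->
  gebauer_moller O M v B.
Proof.
move=> hB complete; split=> [b /hB[i [j [iv jv pij ->]]]|x].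
  by split; [apply: bW_first|apply: bW_homogeneous].
by split=> [|[]]; [apply: pair_syzygies_sound|apply: complete].
Qed.

(** * Generation of the kernel by pair syzygies *)

Hypothesis pidR : principal_ideal_domain R.

(* The coefficient of e_s rho times c_s lies in the ideal generated by the c_i
   of the other symbols with the same image term; distributivity writes it as a
   sum of multiples of the c2 i s, so that the b_W (i, s) cancel it. *)
Lemma elim_coeff B s x (r : 'X_{1..n}) :
    syzmod_first s.+1 x -> syz_map O M x = 0 ->
    (forall i, (i < s)%N -> mpos (M i) = mpos (M s) -> syz_span B (bW i s)) ->
  exists y, syz_span B y /\
    forall k : 'I_u * 'X_{1..n}, (s <= k.1)%N ->
      coeff k y = coeff k << coeff (s, r) x *g (s, r) >>.
Proof.
move=> /syz_firstP xs x0 Bs; pose T := (mterm (M s) + r)%MM.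
have Ts : (mterm (M s) <= T)%MM by apply: lem_addr.
have rE : r = (T - mterm (M s))%MM by rewrite /T addmC addmK.
pose P i := [&& mpos (M i) == mpos (M s), (mterm (M i) <= T)%MM & (i < s)%N].
(* This is the kernel relation at the term [T], solved for the contribution of [s]; indices above
   [s] do not occur in [x]. *)
have eE : coeff (s, r) x * mcf (M s) =
    \sum_(i | P i) - coeff (i, (T - mterm (M i))%MM) x * mcf (M i).
  under eq_bigr => i _ do rewrite mulNr.
  rewrite sumrN; apply/eqP; rewrite -addr_eq0; apply/eqP.
  rewrite -[RHS](syz_map_coord T (mpos (M s)) x0) [RHS](bigD1 s) /=; last first.
    by rewrite eqxx Ts.
  rewrite -rE; congr (_ + _); rewrite [RHS](bigID (fun i => i < s)%N) /=.
  rewrite [X in _ + X]big1 ?addr0 => [|i /andP[/andP[_ i_s] s_i]].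
    apply: eq_bigl => i; rewrite /P -!andbA; do 2![congr (_ && _)].
    by rewrite andb_idl // => i_s; rewrite -val_eqE /= ltn_eqF.
  by rewrite xs ?mul0r // ltn_neqAle leqNgt s_i andbT eq_sym.
have [|f [fE fP]] := @pid_distrib _ pidR _ P (fun i => mcf (M i))
   (fun i => - coeff (i, (T - mterm (M i))%MM) x) (mcf (M s)).
  by rewrite -eE; exists (coeff (s, r) x).
(* Both [c_i] and [c_s] divide [f i], so each summand is a multiple of [bW i s]. *)
exists (\sum_(i | P i) (lift_elt (f i) T s - lift_elt (f i) T i)); split.
  apply: big_ind => [|y z|i Pi]; [exact: sspan0|exact: syz_spanD|].
  have [fi fs] := fP i Pi; move: Pi => /and3P[/eqP pis Ti i_s].
  by apply: lift_elt_span => //; apply: Bs.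
move=> k sk; rewrite raddf_sum /=.
(* At indices from [s] on, the lifts at [i < s] vanish and only the symbol [(s, r)] is left. *)
under eq_bigr => i Pi.
  rewrite coeffB [X in _ - X]coeffU; case: eqP => [ki|_].
    by move: sk Pi; rewrite -ki /P ltnNge => -> /and3P[].
  rewrite mulr0 subr0 /lift_elt -rE coeffU; over.
rewrite -big_distrl /= coeffU; congr (_ * _); apply: (mulIf (M_neq0 s)).
rewrite eE fE big_distrl; apply: eq_bigr => i Pi.
by rewrite /= exquoK //; case: (fP i Pi).
Qed.

(** [elim_coeff] is applied to each symbol over [s] in the support of [x], and the results are
    added. *)
Lemma elim_last B s x : syzmod_first s.+1 x -> syz_map O M x = 0 ->
    (forall i, (i < s)%N -> mpos (M i) = mpos (M s) -> syz_span B (bW i s)) ->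
  exists y, syz_span B y /\  syzmod_first s (x - y).
Proof.
move=> xs x0 Bs.
have [y [yB yE]] : exists y, syz_span B y /\
      forall k : 'I_u * 'X_{1..n}, (s <= k.1)%N ->
    coeff k y = \sum_(k' <- dom x | k'.1 == s) coeff k << coeff k' x *g k' >>.
  elim: (dom x) => [|[j r] ks [y [yB yE]]].
    exists 0; split=> [|k _]; first exact: sspan0.
    by rewrite big_nil coeff0.
  case: (eqVneq j s) => [->|js]; last first.
    by exists y; split=> // k sk; rewrite big_cons /= (negPf js) yE.
  have [z [zB zE]] := elim_coeff r xs x0 Bs.
  exists (z + y); split=> [|k sk]; first exact: syz_spanD.
  by rewrite big_cons /= eqxx coeffD zE ?yE.
exists y; split=> //; apply/syz_firstP => k sk.
rewrite coeffB yE // -{1}[x]freeg_sumE raddf_sum /=.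
rewrite (bigID (fun k' => k'.1 == s)) /= addrAC subrr add0r.
rewrite big_seq_cond big1 // => k' /andP[/xs k's nk's]; rewrite coeffU.
case: eqP => [kk'|_]; last by rewrite mulr0.
have k'lt : (k'.1 < s)%N by rewrite ltn_neqAle nk's -ltnS.
by move: sk; rewrite -kk' leqNgt k'lt.
Qed.

(** [elim_last] subtracts from [x] an element of the span, itself in the kernel, and leaves a kernel
    element supported on smaller indices. *)
Lemma kernel_span V B : pair_syzygies V B ->
    (forall i j, (i < j)%N -> (j < V)%N -> mpos (M i) = mpos (M j) ->
       syz_span B (bW i j)) ->
  forall x, syzmod_first V x -> syz_map O M x = 0 -> syz_span B x.
Proof.
(* [V] stays the bound on the generators, while [v <= V] bounds the support of [x]. *)
move=> hB Bij x; move: (leqnn V); move: {1 3}V => v.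
elim: v x => [|v IH] x vV xv x0.
  suff -> : x = 0 by apply: sspan0.
  by apply/eqP/freeg_eqP => k; rewrite coeff0; move/syz_firstP: xv => ->.
(* If [u <= v], every index is below [v] and there is nothing to eliminate. *)
case: (ltnP v u) => [vu|uv]; last first.
  by apply: IH => // [|k _]; [apply: ltnW|apply: leq_trans uv].
pose s := Ordinal vu.
have [i i_s pis|y [yB yv]] := @elim_last B s x xv x0.
  exact: Bij.
have [_ y0] := pair_syzygies_sound hB yB.
rewrite -(subrK y x); apply: syz_spanD yB.
by apply: IH; rewrite ?syz_mapB ?x0 ?y0 ?subrr //; apply: ltnW.
Qed.

(** * A rank for divisibility, the cocycle identity and redundant pairs *)

(** A natural number that strictly grows along proper divisibility of the [M2], for use in
    inductions. Excluded middle makes a boolean of divisibility, which is not assumed decidable. *)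
Definition dvd_rank i j : nat :=
  #|[pred p : 'I_u * 'I_u |
     if excluded_middle_informative (mono_dvd (M2 p.1 p.2) (M2 i j))
     then true else false]|.

Lemma dvd_rank_le i j i' j' :
  mono_dvd (M2 i' j') (M2 i j) -> (dvd_rank i' j' <= dvd_rank i j)%N.
Proof.
move=> d; apply: subset_leq_card; apply/subsetP => p; rewrite !inE.
case: excluded_middle_informative => // d' _.
case: excluded_middle_informative => // -[].
exact: mono_dvd_trans d' d.
Qed.

Lemma dvd_rank_lt i j i' j' :
    mono_dvd (M2 i' j') (M2 i j) -> ~ mono_eq (M2 i' j') (M2 i j) ->
  (dvd_rank i' j' < dvd_rank i j)%N.
Proof.
move=> d ne; apply: proper_card; apply/properP; split.
  apply/subsetP => p; rewrite !inE.
  case: excluded_middle_informative => // d' _.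
  by case: excluded_middle_informative => // -[]; apply: mono_dvd_trans d' d.
(* [(i, j)] counts in its own rank, but not in that of [(i', j')], by antisymmetry up to units. *)
exists (i, j); rewrite !inE /=.
  case: excluded_middle_informative => // -[]; exact: mono_dvd_refl.
case: excluded_middle_informative => // d'.
by case: ne; apply: mono_dvd_antisym.
Qed.


Variable c3 : 'I_u -> 'I_u -> 'I_u -> R.
Hypothesis c3P : forall i j k, mpos (M i) = mpos (M j) ->
  mpos (M j) = mpos (M k) ->
  is_lcm [:: mcf (M i); mcf (M j); mcf (M k)] (c3 i j k).

Lemma c3_dvd i j k : mpos (M i) = mpos (M j) -> mpos (M j) = mpos (M k) ->
  [/\ dvdr (mcf (M i)) (c3 i j k), dvdr (mcf (M j)) (c3 i j k)
    & dvdr (mcf (M k)) (c3 i j k)].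
Proof.
move=> pij pjk; have h := (c3P pij pjk (c3 i j k)).1 (dvdr_refl _).
by split; apply: h; rewrite !inE eqxx ?orbT.
Qed.

(** Brought to the common multiple [M3 i j k], the summands become differences of lifts at [i], [j],
    [k], and they telescope. *)
Lemma bW_cocycle i j k : mpos (M i) = mpos (M j) -> mpos (M j) = mpos (M k) ->
    exquo (c3 i j k) (c2 i k) *: syz_act (bW i k) (tau3 M i j k - tau2 i k)%MM
  - exquo (c3 i j k) (c2 i j) *: syz_act (bW i j) (tau3 M i j k - tau2 i j)%MM
  + exquo (c3 i j k) (c2 k j) *: syz_act (bW k j) (tau3 M i j k - tau2 k j)%MM
  = 0.
Proof.
move=> pij pjk; have [ci cj ck] := c3_dvd pij pjk.
have tk : (mterm (M k) <= tau3 M i j k)%MM by apply: lem_mlcmr.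
have /andP[ti tj] : (mterm (M i) <= tau3 M i j k)%MM &&
  (mterm (M j) <= tau3 M i j k)%MM by rewrite -lem_mlcm; apply: lem_mlcml.
rewrite !bW_mul // ?pij // opprB subrKA.
by rewrite -opprB addNr.
Qed.

(* Induction on the divisibility order of the M2 i j, then on the larger index:
   in case (b) of redundancy M2 i k may be equal to M2 i j. *)
Lemma nonredundant_span B :
    (forall i j, (i < j)%N -> mpos (M i) = mpos (M j) ->
       ~ redundant M c2 c3 i j -> B (bW i j)) ->
  forall i j, mpos (M i) = mpos (M j) -> syz_span B (bW i j).
Proof.
(* A lexicographic measure in one number, since [maxn i j < u]. *)
move=> hB i j; pose mu i j := (dvd_rank i j * u + maxn i j)%N.
have [N] := ubnP (mu i j); elim: N i j => // N IH i j.
rewrite ltnS => muN pij; wlog ij : i j muN pij / (i < j)%N.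
  move=> wlog_ij; case: (ltngtP i j) => [|ji|/val_inj->]; first exact: wlog_ij.
    rewrite bW_sym; apply: syz_spanN; apply: wlog_ij => //.
    by rewrite /mu maxnC /dvd_rank M2_sym.
  by rewrite bW_diag; apply: sspan0.
have rank_lt i' j' :
    mpos (M i') = mpos (M j') -> mono_dvd (M2 i' j') (M2 i j) ->
    ~ mono_eq (M2 i' j') (M2 i j) -> syz_span B (bW i' j').
  move=> p' d ne; apply: IH => //; apply: leq_trans muN.
  apply: leq_trans (leq_addr _ _).
  apply: (@leq_trans ((dvd_rank i' j').+1 * u)).
    by rewrite mulSnr ltn_add2l gtn_max !ltn_ord.
  by rewrite leq_mul2r dvd_rank_lt ?orbT.
have [|nr] := classic (redundant M c2 c3 i j); last first.
  by apply: syz_span_gen; apply: hB.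
have Mi := mono_dvd_M2l pij; have Mj := mono_dvd_M2r pij.
case=> -[k [jk pki]].
  (* Case (a): [M k] divides [M2 i j], and both [M2 i k] and [M2 j k] are proper divisors of it. *)
  move=> /mono_eq_dvd d3 nik njk.
  have pjk : mpos (M j) = mpos (M k) by rewrite pki pij.
  have Mk : mono_dvd (M k) (M2 i j).
    apply: mono_dvd_trans d3; split; rewrite //=.
      by case: (c3_dvd pij pjk).
    exact: lem_mlcmr.
  apply: (@bW_exchange B i j k) => //.
    by apply: rank_lt => //; apply: M2_dvd.
  apply: rank_lt; rewrite ?pjk //; first exact: M2_dvd.
  by rewrite M2_sym ?pjk // => /mono_eq_sym.
(* Case (b): [M2 j k] is a proper divisor; for [(i, k)] the larger index drops below [j]. *)
move=> djk njk.
have pjk : mpos (M j) = mpos (M k) by rewrite pki pij.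
have Mk : mono_dvd (M k) (M2 i j).
  by apply: mono_dvd_trans djk; apply: mono_dvd_M2r.
apply: (@bW_exchange B i j k) => //.
  apply: IH => //; apply: leq_trans muN; rewrite /mu -addnS leq_add //.
    by rewrite leq_mul2r dvd_rank_le ?orbT //; apply: M2_dvd.
  by rewrite (maxn_idPr (ltnW ij)) gtn_max ij.
apply: rank_lt; rewrite ?pjk //; rewrite M2_sym ?pjk //.
by move/mono_eq_sym.
Qed.

(** * Useful sets of pairs *)

Variable g : 'I_u -> 'rV[O]_m.

Lemma coprime_pair_pos i j :
  coprime_pair g M c2 i j -> mpos (M i) = mpos (M j).
Proof.
case=> -[m1 _] _; move: (mpos _) (mpos _); rewrite m1 => p q.
by rewrite !ord1.
Qed.

(** By [kernel_span], it is enough to span every [bW i j] below [v]; quantifying over [B] hides the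
    form of the generating set. *)
Lemma useful_pairs_intro v (GM : 'I_u -> 'I_u -> Prop) :
    (forall i j, GM i j ->
       [/\ (i < j)%N, (j < v)%N & mpos (M i) = mpos (M j)]) ->
    (forall B : syzmod R n u -> Prop,
       (forall i j, (i < j)%N -> (j < v)%N ->
          GM i j \/ coprime_pair g M c2 i j -> B (bW i j)) ->
       forall i j, (i < j)%N -> (j < v)%N -> mpos (M i) = mpos (M j) ->
         syz_span B (bW i j)) ->
  useful_pairs g M c2 v GM.
Proof.
move=> GMv spanB; split=> //.
set B := fun b => _.
have hB : pair_syzygies v B.
  move=> b [i [j [ij jv GMij ->]]]; exists i, j; split=> //.
    exact: ltn_trans jv.
  by case: GMij => [/GMv[]|/coprime_pair_pos].
apply: (gebauer_moller_intro hB); apply: (kernel_span hB); apply: spanB.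
by move=> i j ij jv GMij; exists i, j.
Qed.

(** [bW i j] lies in the kernel, hence in the span of the generators given by [GM] and the coprime
    pairs, all of them in [B]. *)
Lemma useful_pairs_span v GM B : useful_pairs g M c2 v GM ->
    (forall i j, (i < j)%N -> (j < v)%N -> GM i j \/ coprime_pair g M c2 i j ->
       B (bW i j)) ->
  forall i j, (i < v)%N -> (j < v)%N -> mpos (M i) = mpos (M j) ->
    syz_span B (bW i j).
Proof.
move=> [_ [_ gm]] hB i j iv jv pij.
have : syz_span (fun b => exists i j : 'I_u, [/\ (i < j)%N, (j < v)%N,
    GM i j \/ coprime_pair g M c2 i j & b = bW i j]) (bW i j).
  apply/gm; split; first exact: bW_first.
  by rewrite -[bW i j]syz_actm0 syz_map_bW_act.
apply: syz_span_trans => b [i' [j' [ij' jv' GMij' ->]]].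
by apply: syz_span_gen; apply: hB.
Qed.

Lemma useful_pairs_nonredundant :
  useful_pairs g M c2 u (fun i j : 'I_u =>
    [/\ (i < j)%N, mpos (M i) = mpos (M j) & ~ redundant M c2 c3 i j]).
Proof.
apply: useful_pairs_intro => [i j [ij pij _]|B hB i j _ _].
  by split; rewrite ?ltn_ord.
by apply: nonredundant_span => i' j' ij' pij' nr; apply: hB => //; left.
Qed.

(** Pairs below [s] are covered by [GM]. A pair [(j, s)] is traded, by induction on the rank, for
    some [(i, s)] with [M2 i s] dividing [M2 j s]. *)
Lemma useful_pairs_extend s (GM : 'I_u -> 'I_u -> Prop)
    (imu : mono R n m -> 'I_u) :
    useful_pairs g M c2 s GM ->
    (forall mu, Mbar M c2 s mu -> ~ Mbar' g M c2 s mu ->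
       [/\ (imu mu < s)%N, mpos (M (imu mu)) = mpos (M s)
         & mono_eq mu (M2 (imu mu) s)]) ->
  useful_pairs g M c2 s.+1 (fun i j : 'I_u =>
    GM i j \/
    exists mu, [/\ Mbar M c2 s mu, ~ Mbar' g M c2 s mu, i = imu mu & j = s]).
Proof.
move=> GMs imuP.
apply: useful_pairs_intro => [i j|B hB i j ij].
  case=> [/GMs.1[ij js pij]|[mu [mu1 mu2 -> ->]]].
    by split=> //; apply: leqW.
  by have [? ? _] := imuP mu mu1 mu2.
have Bs i' j' : (i' < s)%N -> (j' < s)%N -> mpos (M i') = mpos (M j') ->
    syz_span B (bW i' j').
  apply: (useful_pairs_span GMs) => i1 j1 ij1 js1 GM1.
  by apply: hB => //; [apply: leqW|case: GM1; [left; left|right]].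
rewrite ltnS leq_eqVlt => /predU1P[/val_inj js|js pij]; last first.
  by apply: Bs => //; apply: ltn_trans js.
rewrite {j}js in ij *.
have [N] := ubnP (dvd_rank i s); elim: N i ij => // N IH j js.
rewrite ltnS => jN pjs; have muM : Mbar M c2 s (M2 j s) by exists j.
(* [M i] divides [M2 i s], hence [M2 j s]; the exchange through [i] leaves [bW j i], whose indices
   are below [s]. *)
have close i : (i < s)%N -> mpos (M i) = mpos (M s) ->
    mono_dvd (M2 i s) (M2 j s) -> syz_span B (bW i s) -> syz_span B (bW j s).
  move=> i_s pis d Bis; apply: (@bW_exchange B j s i) => //.
    by apply: mono_dvd_trans d; apply: mono_dvd_M2l.
  by apply: Bs => //; rewrite pis.
have [[_ [|]]|nMbar] := classic (Mbar' g M c2 s (M2 j s)).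
- move=> [_ [[j' [js' pjs' ->]] d ne]]; apply: (close j') => //.
  apply: IH => //.
  apply: leq_trans jN; apply: dvd_rank_lt => // /mono_eq_sym; exact: ne.
(* Here [(i, s)] is a coprime pair, so [bW i s] is already a generator. *)
- move=> [ic [i [i_s mi ei]]].
  have cp : coprime_pair g M c2 i s by [].
  apply: (close i); rewrite ?(coprime_pair_pos cp) //; first exact: mono_eq_dvd.
  by apply: syz_span_gen; apply: hB => //; right.
(* Otherwise the chosen index for [M2 j s] gives one of the new pairs. *)
have [i_s pis e] := imuP _ muM nMbar.
apply: (close _ i_s pis); first exact/mono_eq_dvd/mono_eq_sym.
by apply: syz_span_gen; apply: hB => //; left; right; exists (M2 j s).
Qed.

End PairSyzygies.

(** * Nonzero leading coefficients and the three statements together *)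

Lemma max_mono_neq0 (R : nzRingType) (n m : nat) (O : multiOre R n)
    (leM : rel ('X_{1..n} * 'I_m)) (f : 'rV[O]_m) (N : mono R n m) :
  is_max_mono leM f N -> mcf N != 0.
Proof. by case=> p [_ Np <- _]; rewrite -mem_dom. Qed.

Theorem lemma74 (R : idomainType) (pidR : principal_ideal_domain R)
    (n m u : nat) (O : multiOre R n)
    (leT : rel 'X_{1..n}) (leM : rel ('X_{1..n} * 'I_m))
    (leT_order : term_order leT) (leM_order : module_term_order leT leM)
    (g : 'I_u -> 'rV[O]_m) (g_neq0 : forall i, g i != 0)
    (M : 'I_u -> mono R n m) (gM : forall i, is_max_mono leM (g i) (M i))
    (c2 : 'I_u -> 'I_u -> R) (c3 : 'I_u -> 'I_u -> 'I_u -> R)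
    (c2P : forall i j, mpos (M i) = mpos (M j) ->
       is_lcm [:: mcf (M i); mcf (M j)] (c2 i j))
    (c2C : forall i j, c2 i j = c2 j i)
    (c3P : forall i j k, mpos (M i) = mpos (M j) -> mpos (M j) = mpos (M k) ->
       is_lcm [:: mcf (M i); mcf (M j); mcf (M k)] (c3 i j k)) :
  [/\
    (* (1) *)
    forall i j k : 'I_u,
      mpos (M i) = mpos (M j) -> mpos (M j) = mpos (M k) ->
        exquo (c3 i j k) (c2 i k) *:
          syz_act (bW M c2 i k) (tau3 M i j k - tau2 M i k)%MM
      - exquo (c3 i j k) (c2 i j) *:
          syz_act (bW M c2 i j) (tau3 M i j k - tau2 M i j)%MM
      + exquo (c3 i j k) (c2 k j) *:
          syz_act (bW M c2 k j) (tau3 M i j k - tau2 M k j)%MM = 0,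
    (* (2) *)
    useful_pairs g M c2 u (fun i j : 'I_u =>
      [/\ (i < j)%N, mpos (M i) = mpos (M j) & ~ redundant M c2 c3 i j])
  & (* (3), with g s the last element of the subfamily G *)
    forall (s : 'I_u) (GM : 'I_u -> 'I_u -> Prop),
      useful_pairs g M c2 s GM ->
      forall imu : mono R n m -> 'I_u,
        (forall mu, Mbar M c2 s mu -> ~ Mbar' g M c2 s mu ->
           [/\ (imu mu < s)%N, mpos (M (imu mu)) = mpos (M s)
             & mono_eq mu (M2 M c2 (imu mu) s)]) ->
        (forall mu nu,
           Mbar M c2 s mu -> ~ Mbar' g M c2 s mu ->
           Mbar M c2 s nu -> ~ Mbar' g M c2 s nu ->
           mono_eq mu nu -> imu mu = imu nu) ->
        useful_pairs g M c2 s.+1 (fun i j : 'I_u =>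
          GM i j \/
          exists mu, [/\ Mbar M c2 s mu, ~ Mbar' g M c2 s mu,
                         i = imu mu & j = s])].
Proof.
have M0 i : mcf (M i) != 0 by apply: max_mono_neq0 (gM i).
split.
- exact: bW_cocycle.
- exact: useful_pairs_nonredundant.
by move=> s GM GMs imu imuP _; apply: useful_pairs_extend.
Qed.
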